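(* Let $\mathbf{n}$ be an infinite supernatural number (i.e. not a natural number). For every field $F$ there are uncountably many pairwise nonisomorphic locally simple modules over $\operatorname{M}_{\mathbf{n}}(F)$.
   Context: A supernatural number is a formal product $\prod_p p^{\alpha_p}$ over the primes, with $\alpha_p\in\mathbb{N}\cup\{\infty\}$ ($0$ allowed). The supernatural matrix algebra $\operatorname{M}_{\mathbf{n}}(F)$ is the direct limit of the matrix algebras $\operatorname{M}_n(F)$ over the natural divisors $n$ of $\mathbf{n}$, with the maps $\operatorname{M}_m(F)\to\operatorname{M}_n(F)$, $x\mapsto x\otimes 1=\operatorname{diag}(x,\dots,x)$, whenever $m\mid n$. A nonzero module $V$ over $A=\operatorname{M}_{\mathbf{n}}(F)$ is locally simple if there are a presentation $A=\varinjlim(A_n,\varphi_n)$ as a direct limit of a sequence of finite dimensional central simple $F$-algebras, finite dimensional simple modules $V_n$ over $A_n$, and linear maps $f_n\colon V_n\to V_{n+1}$ satisfying $f_n(ax)=\varphi_n(a)f_n(x)$ for all $a\in A_n$, $x\in V_n$, such that $V=\varinjlim(V_n,f_n)$ with the induced $A$-action. *)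

(* Defs.v *)
From HB Require Import structures.
From mathcomp Require Import all_boot all_order all_algebra all_field.
From mathcomp Require Import generic_quotient.
From mathcomp Require Import classical_sets cardinality.

Set Implicit Arguments.
Unset Strict Implicit.
Unset Printing Implicit Defensive.

Import GRing.Theory.
Local Open Scope ring_scope.

(* The formal product of the p ^ (s p), with None standing for the exponent   *)
(* infinity.  Only the values of s at prime numbers are ever used.            *)
Definition supernatural := nat -> option nat.

Definition sn_natural (s : supernatural) : Prop :=
  exists2 m : nat, (0 < m)%N & forall p, prime p -> s p = Some (logn p m).

Definition sn_infinite (s : supernatural) : Prop := ~ sn_natural s.

(* Only the primes in primes d need a test: the others have exponent 0 in d.  *)
Definition sn_dvd (d : nat) (s : supernatural) : bool :=
  (0 < d)%N &&
  all (fun p => if s p is Some a then (logn p d <= a)%N else true) (primes d).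

Definition sn_divisor (s : supernatural) : Type := {d : nat | sn_dvd d s}.

Definition sn_divisor_val (s : supernatural) (d : sn_divisor s) : nat := sval d.
Coercion sn_divisor_val : sn_divisor >-> nat.

HB.instance Definition _ s := Choice.copy (sn_divisor s) {d : nat | sn_dvd d s}.

Section Divisors.
Variable s : supernatural.
Implicit Types d e k : sn_divisor s.

Lemma sn_divisor_gt0 d : (0 < d)%N.
Proof. by case: d => d /= /andP[]. Qed.

Lemma sn_dvd1 : sn_dvd 1 s. Proof. by []. Qed.
Definition sn_div1 : sn_divisor s := exist _ 1%N sn_dvd1.

Lemma sn_dvdP (m : nat) : reflect
  ((0 < m)%N /\ forall p a, prime p -> s p = Some a -> (logn p m <= a)%N)
  (sn_dvd m s).
Proof.
apply: (iffP andP) => -[m0 H]; split=> //.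
  move=> p a pp sp; have [pm|pm] := boolP (p \in primes m).
    by have /allP/(_ _ pm) := H; rewrite sp.
  by have := pm; rewrite -logn_gt0 -eqn0Ngt => /eqP->.
apply/allP => p; rewrite mem_primes => /and3P[pp _ _].
by case E: (s p) => [a|//]; apply: H.
Qed.

Lemma sn_dvd_lcm d e : sn_dvd (lcmn d e) s.
Proof.
have [/sn_dvdP[d0 Hd] /sn_dvdP[e0 He]] := (valP d, valP e).
apply/sn_dvdP; split=> [|p a pp sp]; first by rewrite lcmn_gt0 !sn_divisor_gt0.
by rewrite logn_lcm ?sn_divisor_gt0 // geq_max (Hd p a) ?(He p a).
Qed.
Definition sn_lcm d e : sn_divisor s := exist _ (lcmn d e) (sn_dvd_lcm d e).

End Divisors.

Section SupernaturalMatrixAlgebra.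
Variables (F : fieldType) (s : supernatural).
Implicit Types d e k : sn_divisor s.

Definition sn_ord d (i : nat) : 'I_d := Ordinal (ltn_pmod i (sn_divisor_gt0 d)).

(* x |-> diag(x, ..., x); only meant for d %| e.                              *)
Definition blockdiag d e (x : 'M[F]_d) : 'M[F]_e :=
  \matrix_(i < e, j < e)
    if (i %/ d == j %/ d)%N then x (sn_ord d i) (sn_ord d j) else 0.

Lemma blockdiagD d e (x y : 'M[F]_d) :
  blockdiag e (x + y) = blockdiag e x + blockdiag e y.
Proof. by apply/matrixP => i j; rewrite !mxE; case: ifP; rewrite ?addr0. Qed.

Lemma blockdiagZ d e (c : F) (x : 'M[F]_d) :
  blockdiag e (c *: x) = c *: blockdiag e x.
Proof. by apply/matrixP => i j; rewrite !mxE; case: ifP; rewrite ?mulr0. Qed.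

Lemma blockdiag1 d e : blockdiag e (1%:M : 'M[F]_d) = 1%:M.
Proof.
apply/matrixP => i j; rewrite !mxE -!val_eqE /=.
case: ifPn => ij.
  congr (_%:R); congr nat_of_bool; apply/eqP/eqP => [m|->//].
  by rewrite (divn_eq i d) (divn_eq j d) (eqP ij) m.
by case: eqP => // ijE; rewrite ijE eqxx in ij.
Qed.

Lemma blockdiagM d e (x y : 'M[F]_d) : (d %| e)%N ->
  blockdiag e (x *m y) = blockdiag e x *m blockdiag e y.
Proof.
move=> de; apply/matrixP => i j; rewrite !mxE.
have d0 := sn_divisor_gt0 d.
have lt (a : 'I_d) : (i %/ d * d + a < e)%N.
  have : (i %/ d < e %/ d)%N by rewrite ltn_divLR // divnK.
  rewrite -(leq_pmul2r d0) divnK // mulSn => /(leq_trans _); apply.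
  by rewrite addnC ltn_add2r.
pose h (a : 'I_d) : 'I_e := Ordinal (lt a).
have hd a : (h a %/ d = i %/ d)%N by rewrite /= (divnMDl _ _ d0) (divn_small (ltn_ord a)) addn0.
have hm a : sn_ord d (h a) = a.
  by apply: val_inj; rewrite /= modnMDl (modn_small (ltn_ord a)).
rewrite (bigID (fun k : 'I_e => (k %/ d == i %/ d)%N)) /=.
rewrite [X in _ + X]big1 ?addr0; last first.
  by move=> k; rewrite eq_sym mxE => /negPf->; rewrite mul0r.
rewrite (reindex_onto h (fun k : 'I_e => sn_ord d k)); last first.
  move=> k /eqP kd; apply: val_inj; rewrite /= -kd; exact/esym/divn_eq.
rewrite [RHS](eq_bigl predT); last by move=> a; rewrite hd hm !eqxx.
case: ifP => ij; last by rewrite big1 // => a _; rewrite !mxE hd ij mulr0.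
apply: eq_bigr => a _.
by rewrite !mxE hm hd eqxx ij.
Qed.

Lemma blockdiag_comp d e k (x : 'M[F]_d) : (d %| e)%N ->
  blockdiag k (blockdiag e x) = blockdiag k x.
Proof.
move=> de; apply/matrixP => i j; rewrite !mxE /=.
have d0 := sn_divisor_gt0 d.
have dq (a : nat) : (a %/ d = a %/ e * (e %/ d) + a %% e %/ d)%N.
  by rewrite -divnMDl // -mulnA (divnK de) -divn_eq.
have ml (a : nat) : (a %% e %/ d < e %/ d)%N.
  by rewrite ltn_divLR // divnK // ltn_pmod ?sn_divisor_gt0.
have o (a : nat) : sn_ord d (a %% e)%N = sn_ord d a.
  by apply: val_inj; rewrite /= modn_dvdm.
rewrite !o; have [ij|ij] := eqVneq (i %/ e)%N (j %/ e)%N.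
  by rewrite (dq i) (dq j) ij eqn_add2l.
case: eqP => // H; case/eqP: ij.
have q0 : (0 < e %/ d)%N by rewrite divn_gt0 // dvdn_leq ?sn_divisor_gt0.
have := congr1 (divn^~ (e %/ d)%N) H.
by rewrite (dq i) (dq j) !divnMDl // !(divn_small (ml _)) !addn0.
Qed.

Lemma blockdiag_id d (x : 'M[F]_d) : blockdiag d x = x.
Proof.
have o (i : 'I_d) : sn_ord d i = i by apply: val_inj; rewrite /= modn_small.
by apply/matrixP => i j; rewrite !mxE !o !divn_small.
Qed.

Lemma blockdiag_inj d e : (d %| e)%N -> injective (@blockdiag d e).
Proof.
move=> de x y xy; rewrite -[x]blockdiag_id -[y]blockdiag_id.
by rewrite -(blockdiag_comp _ x de) xy blockdiag_comp.
Qed.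

Definition smx_pre : Type := {d : sn_divisor s & 'M[F]_d}.
HB.instance Definition _ := Choice.copy smx_pre {d : sn_divisor s & 'M[F]_d}.

(* Equality in the direct limit: it may be tested at the lcm of the two       *)
(* indices because the transition maps are injective; see smx_inP.            *)
Definition smx_rel (u v : smx_pre) : bool :=
  let k := sn_lcm (tag u) (tag v) in
  blockdiag k (tagged u) == blockdiag k (tagged v).

Lemma smx_relP (u v : smx_pre) (k : sn_divisor s) :
  (tag u %| k)%N -> (tag v %| k)%N ->
  smx_rel u v = (blockdiag k (tagged u) == blockdiag k (tagged v)).
Proof.
move=> uk vk; rewrite /smx_rel; set l := sn_lcm _ _.
have ul : (tag u %| l)%N by apply: dvdn_lcml.
have vl : (tag v %| l)%N by apply: dvdn_lcmr.
have lk : (l %| k)%N by rewrite /= dvdn_lcm uk vk.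
by rewrite -(blockdiag_comp k _ ul) -(blockdiag_comp k _ vl) (inj_eq (blockdiag_inj lk)).
Qed.

Lemma smx_rel_equiv : equiv_class_of smx_rel.
Proof.
split=> [u|u v|v u w]; first by rewrite /smx_rel eqxx.
  have uk : (tag u %| sn_lcm (tag v) (tag u))%N by apply: dvdn_lcmr.
  have vk : (tag v %| sn_lcm (tag v) (tag u))%N by apply: dvdn_lcml.
  by rewrite (smx_relP uk vk) eq_sym.
set k := sn_lcm (sn_lcm (tag u) (tag v)) (tag w).
have uk : (tag u %| k)%N by rewrite /k /= -lcmnA dvdn_lcml.
have vk : (tag v %| k)%N by rewrite /k /= (lcmnC (tag u)) -lcmnA dvdn_lcml.
have wk : (tag w %| k)%N by rewrite /k /= dvdn_lcmr.
rewrite (smx_relP uk vk) (smx_relP vk wk) (smx_relP uk wk).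
by move=> /eqP-> /eqP->.
Qed.
Canonical smx_equiv := EquivRelPack smx_rel_equiv.

(* The direct limit of the 'M[F]_d over the divisors d of s: the algebra      *)
(* structure below is the one making the canonical maps smx_in morphisms.     *)
Definition smx : Type := {eq_quot smx_rel}%qT.
HB.instance Definition _ := Choice.on smx.
HB.instance Definition _ := EqQuotient.on smx.

Local Open Scope quotient_scope.

Definition smx_in d (x : 'M[F]_d) : smx := \pi_smx (existT _ d x : smx_pre).

Lemma smx_in_blockdiag d e (x : 'M[F]_d) : (d %| e)%N ->
  smx_in (blockdiag e x) = smx_in x.
Proof.
move=> de; apply/eqmodP; rewrite /= (@smx_relP _ _ e) //=.
by rewrite blockdiag_id.
Qed.

Lemma smx_in_inj d : injective (@smx_in d).
Proof.
move=> x y /eqmodP; rewrite /= (@smx_relP _ _ d) //= => /eqP.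
by rewrite !blockdiag_id.
Qed.

Lemma smx_inP d e (x : 'M[F]_d) (y : 'M[F]_e) :
  smx_in x = smx_in y <->
  exists k : sn_divisor s,
    [/\ (d %| k)%N, (e %| k)%N & blockdiag k x = blockdiag k y].
Proof.
split=> [/eqmodP/eqP xy|[k [dk ek xy]]].
  by exists (sn_lcm d e); split=> //; [apply: dvdn_lcml|apply: dvdn_lcmr].
by rewrite -(smx_in_blockdiag x dk) xy smx_in_blockdiag.
Qed.

Lemma smx_in_surj (a : smx) : exists d (x : 'M[F]_d), a = smx_in x.
Proof.
by elim/quotW: a => -[d x]; exists d, x.
Qed.

Lemma smx_in_surj2 (a b : smx) :
  exists d (x y : 'M[F]_d), a = smx_in x /\ b = smx_in y.
Proof.
have [d [x ->]] := smx_in_surj a; have [e [y ->]] := smx_in_surj b.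
exists (sn_lcm d e), (blockdiag _ x), (blockdiag _ y).
by rewrite !smx_in_blockdiag //; [apply: dvdn_lcmr|apply: dvdn_lcml].
Qed.

Lemma smx_in_surj3 (a b c : smx) :
  exists d (x y z : 'M[F]_d), [/\ a = smx_in x, b = smx_in y & c = smx_in z].
Proof.
have [d [x [y [-> ->]]]] := smx_in_surj2 a b.
have [e [z ->]] := smx_in_surj c.
exists (sn_lcm d e), (blockdiag _ x), (blockdiag _ y), (blockdiag _ z).
by rewrite !smx_in_blockdiag //; [apply: dvdn_lcmr|apply: dvdn_lcml..].
Qed.

Definition smx_op1 (op : forall d, 'M[F]_d -> 'M[F]_d) (a : smx) : smx :=
  smx_in (op _ (tagged (repr a))).

Definition smx_op2 (op : forall d, 'M[F]_d -> 'M[F]_d -> 'M[F]_d)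
    (a b : smx) : smx :=
  let k := sn_lcm (tag (repr a)) (tag (repr b)) in
  smx_in (op k (blockdiag k (tagged (repr a))) (blockdiag k (tagged (repr b)))).

Lemma smx_in_repr (a : smx) : smx_in (tagged (repr a)) = a.
Proof. by rewrite -[RHS]reprK /smx_in; case: (repr a). Qed.

Lemma smx_op1E (op : forall d, 'M[F]_d -> 'M[F]_d) :
    (forall d e (x : 'M[F]_d), (d %| e)%N ->
       blockdiag e (op d x) = op e (blockdiag e x)) ->
  forall d (x : 'M[F]_d), smx_op1 op (smx_in x) = smx_in (op d x).
Proof.
move=> opE d x; rewrite /smx_op1.
have /smx_inP[k [dk ek xy]] := smx_in_repr (smx_in x).
by rewrite -(smx_in_blockdiag _ dk) -[RHS](smx_in_blockdiag _ ek) !opE // xy.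
Qed.

Lemma smx_op2E (op : forall d, 'M[F]_d -> 'M[F]_d -> 'M[F]_d) :
    (forall d e (x y : 'M[F]_d), (d %| e)%N ->
       blockdiag e (op d x y) = op e (blockdiag e x) (blockdiag e y)) ->
  forall d (x y : 'M[F]_d),
    smx_op2 op (smx_in x) (smx_in y) = smx_in (op d x y).
Proof.
move=> opE d x y; rewrite /smx_op2; set u := repr _; set v := repr _.
set l := sn_lcm _ _.
have /smx_inP[k [uk dk xy]] := smx_in_repr (smx_in x).
have /smx_inP[k' [vk' dk' xy']] := smx_in_repr (smx_in y).
have ul : (tag u %| l)%N by apply: dvdn_lcml.
have vl : (tag v %| l)%N by apply: dvdn_lcmr.
pose m := sn_lcm k k'.
have km : (k %| m)%N by apply: dvdn_lcml.
have km' : (k' %| m)%N by apply: dvdn_lcmr.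
have lm : (l %| m)%N by rewrite /= dvdn_lcm (dvdn_trans uk km) (dvdn_trans vk' km').
rewrite -(smx_in_blockdiag _ lm) -[RHS](smx_in_blockdiag _ (dvdn_trans dk km)).
rewrite !opE ?(dvdn_trans dk km) // !blockdiag_comp //.
rewrite -(blockdiag_comp _ _ uk) -(blockdiag_comp _ _ vk').
by rewrite -/u -/v in xy xy' *; rewrite xy xy' !blockdiag_comp.
Qed.

Definition smx_zero : smx := smx_in (0 : 'M[F]_(sn_div1 s)).
Definition smx_one : smx := smx_in (1%:M : 'M[F]_(sn_div1 s)).
Definition smx_opp := smx_op1 (fun d (x : 'M[F]_d) => - x).
Definition smx_scale (c : F) := smx_op1 (fun d (x : 'M[F]_d) => c *: x).
Definition smx_add := smx_op2 (fun d (x y : 'M[F]_d) => x + y).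
Definition smx_mul := smx_op2 (fun d (x y : 'M[F]_d) => x *m y).

Fact smx_in0_sub d : smx_in (0 : 'M[F]_d) = smx_zero.
Proof.
rewrite /smx_zero -(@smx_in_blockdiag (sn_div1 s) d _ (dvd1n d)); congr smx_in.
by rewrite -[X in blockdiag d X](scale0r 0) blockdiagZ scale0r.
Qed.

Fact smx_in1_sub d : smx_in (1%:M : 'M[F]_d) = smx_one.
Proof. by rewrite /smx_one -(@smx_in_blockdiag (sn_div1 s) d _ (dvd1n d)) blockdiag1. Qed.

Fact smx_inD_sub d (x y : 'M[F]_d) :
  smx_add (smx_in x) (smx_in y) = smx_in (x + y).
Proof. by apply: smx_op2E => ? ? ? ? _; apply: blockdiagD. Qed.

Fact smx_inM_sub d (x y : 'M[F]_d) :
  smx_mul (smx_in x) (smx_in y) = smx_in (x *m y).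
Proof. by apply: smx_op2E => ? ? ? ? ?; apply: blockdiagM. Qed.

Fact smx_inZ_sub c d (x : 'M[F]_d) : smx_scale c (smx_in x) = smx_in (c *: x).
Proof. by apply: smx_op1E => ? ? ? _; apply: blockdiagZ. Qed.

Fact smx_inN_sub d (x : 'M[F]_d) : smx_opp (smx_in x) = smx_in (- x).
Proof.
by apply: smx_op1E => ? ? ? _; rewrite -!scaleN1r blockdiagZ.
Qed.

Fact smx_addA : associative smx_add.
Proof.
move=> a b c; have [d [x [y [z [-> -> ->]]]]] := smx_in_surj3 a b c.
by rewrite !smx_inD_sub addrA.
Qed.
Fact smx_addC : commutative smx_add.
Proof.
move=> a b; have [d [x [y [-> ->]]]] := smx_in_surj2 a b.
by rewrite !smx_inD_sub addrC.
Qed.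
Fact smx_add0 : left_id smx_zero smx_add.
Proof.
move=> a; have [d [x ->]] := smx_in_surj a.
by rewrite -(smx_in0_sub d) smx_inD_sub add0r.
Qed.
Fact smx_addN : left_inverse smx_zero smx_opp smx_add.
Proof.
move=> a; have [d [x ->]] := smx_in_surj a.
by rewrite smx_inN_sub smx_inD_sub addNr smx_in0_sub.
Qed.
HB.instance Definition _ :=
  GRing.isZmodule.Build smx smx_addA smx_addC smx_add0 smx_addN.

Lemma smx_in0 d : smx_in (0 : 'M[F]_d) = 0. Proof. exact: smx_in0_sub. Qed.
Lemma smx_inD d (x y : 'M[F]_d) : smx_in (x + y) = smx_in x + smx_in y.
Proof. exact/esym/smx_inD_sub. Qed.

Fact smx_mulA : associative smx_mul.
Proof.
move=> a b c; have [d [x [y [z [-> -> ->]]]]] := smx_in_surj3 a b c.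
by rewrite !smx_inM_sub mulmxA.
Qed.
Fact smx_mul1 : left_id smx_one smx_mul.
Proof.
move=> a; have [d [x ->]] := smx_in_surj a.
by rewrite -(smx_in1_sub d) smx_inM_sub mul1mx.
Qed.
Fact smx_mul1r : right_id smx_one smx_mul.
Proof.
move=> a; have [d [x ->]] := smx_in_surj a.
by rewrite -(smx_in1_sub d) smx_inM_sub mulmx1.
Qed.
Fact smx_mulDl : left_distributive smx_mul +%R.
Proof.
move=> a b c; have [d [x [y [z [-> -> ->]]]]] := smx_in_surj3 a b c.
by rewrite -smx_inD !smx_inM_sub mulmxDl smx_inD.
Qed.
Fact smx_mulDr : right_distributive smx_mul +%R.
Proof.
move=> a b c; have [d [x [y [z [-> -> ->]]]]] := smx_in_surj3 a b c.
by rewrite -smx_inD !smx_inM_sub mulmxDr smx_inD.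
Qed.
Fact smx_one_neq0 : smx_one != 0.
Proof.
apply/eqP => /smx_in_inj/matrixP/(_ ord0 ord0); rewrite !mxE eqxx => /eqP.
by rewrite oner_eq0.
Qed.
HB.instance Definition _ := GRing.Zmodule_isNzRing.Build smx
  smx_mulA smx_mul1 smx_mul1r smx_mulDl smx_mulDr smx_one_neq0.

Lemma smx_in1 d : smx_in (1%:M : 'M[F]_d) = 1. Proof. exact: smx_in1_sub. Qed.
Lemma smx_inM d (x y : 'M[F]_d) : smx_in (x *m y) = smx_in x * smx_in y.
Proof. exact/esym/smx_inM_sub. Qed.

Fact smx_scaleA b c a : smx_scale b (smx_scale c a) = smx_scale (b * c) a.
Proof.
by have [d [x ->]] := smx_in_surj a; rewrite !smx_inZ_sub scalerA.
Qed.
Fact smx_scale1 : left_id 1 smx_scale.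
Proof.
by move=> a; have [d [x ->]] := smx_in_surj a; rewrite smx_inZ_sub scale1r.
Qed.
Fact smx_scaleDr : right_distributive smx_scale +%R.
Proof.
move=> c a b; have [d [x [y [-> ->]]]] := smx_in_surj2 a b.
by rewrite -smx_inD !smx_inZ_sub scalerDr smx_inD.
Qed.
Fact smx_scaleDl a : {morph smx_scale^~ a : b c / b + c}.
Proof.
move=> b c; have [d [x ->]] := smx_in_surj a.
by rewrite !smx_inZ_sub scalerDl smx_inD.
Qed.
HB.instance Definition _ := GRing.Zmodule_isLmodule.Build F smx
  smx_scaleA smx_scale1 smx_scaleDr smx_scaleDl.

Lemma smx_inZ c d (x : 'M[F]_d) : smx_in (c *: x) = c *: smx_in x.
Proof. exact/esym/smx_inZ_sub. Qed.

Fact smx_scaleAl (c : F) (a b : smx) : c *: (a * b) = c *: a * b.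
Proof.
have [d [x [y [-> ->]]]] := smx_in_surj2 a b.
by rewrite -smx_inM -!smx_inZ -smx_inM scalemxAl.
Qed.
HB.instance Definition _ := GRing.Lmodule_isLalgebra.Build F smx smx_scaleAl.

Fact smx_scaleAr (c : F) (a b : smx) : c *: (a * b) = a * (c *: b).
Proof.
have [d [x [y [-> ->]]]] := smx_in_surj2 a b.
by rewrite -smx_inM -!smx_inZ -smx_inM scalemxAr.
Qed.
HB.instance Definition _ := GRing.Lalgebra_isAlgebra.Build F smx smx_scaleAr.

End SupernaturalMatrixAlgebra.

Fixpoint seq_trans (X : nat -> Type) (f : forall k, X k -> X k.+1) (l k : nat) :
    X k -> X (l + k)%N :=
  if l is l'.+1 then fun x => f (l' + k)%N (seq_trans f l' x) else id.

(* Y, with the maps g k, is the quotient of the disjoint union of the X k by  *)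
(* eventual equality.  The last clause only compares elements of one stage    *)
(* because the first one lets both be moved to a common stage.  When the f k  *)
(* and g k are morphisms, the structure of Y is that of the direct limit.     *)
Definition is_seq_limit (X : nat -> Type) (f : forall k, X k -> X k.+1)
    (Y : Type) (g : forall k, X k -> Y) : Prop :=
  [/\ forall k x, g k.+1 (f k x) = g k x,
      forall y, exists k x, g k x = y
    & forall k x x', g k x = g k x' ->
        exists l, seq_trans f l x = seq_trans f l x'].

(* falgType algebras are nonzero and finite dimensional by definition.        *)
Definition central_simple (F : fieldType) (B : falgType F) : Prop :=
  'Z({:B})%VS = 1%VS /\
  forall I : {vspace B},
    ({:B} * I <= I)%VS -> (I * {:B} <= I)%VS -> I = 0%VS \/ I = fullv.

Definition simple_module (R : nzRingType) (V : lmodType R) : Prop :=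
  (exists v : V, v != 0) /\
  forall U : {pred V}, GRing.submod_closed U -> U =i pred1 0 \/ U =i predT.

(* Modules over an F-algebra B are F-spaces through c |-> c%:A.               *)
Definition finite_dimensional (F : fieldType) (B : algType F) (V : lmodType B) :
    Prop :=
  exists (m : nat) (b : 'I_m -> V), forall v : V,
    exists c : 'I_m -> F, v = \sum_(i < m) (c i)%:A *: b i.

Definition base_linear (F : fieldType) (B C : algType F)
    (V : lmodType B) (W : lmodType C) (f : V -> W) : Prop :=
  forall (c : F) (u v : V),
    f ((c%:A : B) *: u + v) = (c%:A : C) *: f u + f v.

Definition locally_simple (F : fieldType) (A : algType F) (V : lmodType A) :
    Prop :=
  (exists v : V, v != 0) /\
  exists (A_ : nat -> falgType F)
         (phi : forall k, {lrmorphism A_ k -> A_ k.+1})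
         (iota : forall k, {lrmorphism A_ k -> A})
         (V_ : forall k, lmodType (A_ k))
         (f : forall k, V_ k -> V_ k.+1)
         (g : forall k, V_ k -> V),
    [/\ forall k, central_simple (A_ k),
        is_seq_limit (fun k => phi k) (fun k => iota k),
        forall k, simple_module (V_ k) /\ finite_dimensional (V_ k),
        forall k, base_linear (f k) /\
          forall (a : A_ k) (x : V_ k), f k (a *: x) = phi k a *: f k x
      & is_seq_limit f g /\
        forall k, base_linear (g k) /\
          forall (a : A_ k) (x : V_ k), g k (a *: x) = iota k a *: g k x].

Definition isomorphic_modules (R : nzRingType) (V W : lmodType R) : Prop :=
  exists f : {linear V -> W}, bijective f.

Definition uncountable (I : Type) : Prop := ~ countable (@classical_sets.setT I).

(* Main.v *)
(* Since s is infinite, its divisors have a cofinal chain d_0 | d_1 | ...     *)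
(* with d_(k+1) >= 2 d_k. A 0-1 sequence eps gives the embeddings of column   *)
(* spaces F^(d_k) -> F^(d_(k+1)) onto the block number eps_k, and these have  *)
(* as limit a locally simple module with a vector v that every stage sees as  *)
(* a standard basis vector e_(c_k), where c_(k+1) = eps_k d_k + c_k. An       *)
(* isomorphism to the module of eps' maps v to a vector w fixed by the same   *)
(* idempotents as v, so that the image of w in each large stage is a multiple *)
(* of e_(c_k); as w moves from a stage to the next into block eps'_k, eps_k = *)
(* eps'_k for large k. The sequences eps_k = al (logn 2 (k + 1)) take each    *)
(* value al x infinitely often, so distinct al give modules that are not      *)
(* isomorphic.                                                                *)

Require Import Defs.
From HB Require Import structures.
From mathcomp Require Import all_boot all_order all_algebra all_field.
From mathcomp Require Import generic_quotient ring_quotient.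
From mathcomp Require Import boolp classical_sets cardinality.
From mathcomp Require Import zify.

Set Implicit Arguments.
Unset Strict Implicit.
Unset Printing Implicit Defensive.

Import GRing.Theory.
Local Open Scope ring_scope.

(** Each 0-1 sequence gives a locally simple module, and isomorphic modules have eventually equal
    sequences; uncountably many sequences stay distinct under this relation. In the limit of the
    column spaces the vector v is a generator, and its annihilator consists of the elements that
    come from a matrix with zero column c_k at some stage k. The module is therefore defined as the
    quotient of the algebra by this left ideal, [col_ideal]. The construction rests on transition
    maps that preserve and reflect vanishing of the chosen column, which [col_chain_trans] checks
    for the digit indices; [col_limit_locally_simple] then recovers the column spaces as stages.
    From an isomorphism, [col_limit_iso_support] extracts a constraint on matrices, which
    [digit_module_iso] turns into eventual equality of digits. *)

(** * Quotient of a module by a submodule *)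

Section ModuleQuotient.
Variables (R : nzRingType) (V : lmodType R) (S : {pred V}).
Hypothesis S_submod : GRing.submod_closed S.
Local Open Scope quotient_scope.

HB.instance Definition _ :=
  GRing.isZmodClosed.Build V S (GRing.submod_closedB S_submod).

Definition modquot : Type := Quotient.quot S.
Local Notation Q := modquot.
HB.instance Definition _ := GRing.Zmodule.on Q.

Definition modquot_pi (v : V) : Q := \pi_(Quotient.quot S) v.

Lemma modquot_pi_surj (q : Q) : exists v, q = modquot_pi v.
Proof. by elim/quotW: q => v; exists v. Qed.

Lemma modquot_piP u v : modquot_pi u = modquot_pi v <-> u - v \in S.
Proof. by rewrite Quotient.idealrBE; split=> [/eqP|/eqP]. Qed.

Lemma modquot_piD u v : modquot_pi (u + v) = modquot_pi u + modquot_pi v.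
Proof. by rewrite /modquot_pi !piE. Qed.

Definition modquot_scale (a : R) (q : Q) : Q :=
  modquot_pi (a *: repr (q : Quotient.quot S)).

Lemma modquot_scaleE a v : modquot_scale a (modquot_pi v) = modquot_pi (a *: v).
Proof.
have [S0 SD] := S_submod.
apply/modquot_piP; rewrite -scalerBr -[_ *: _]addr0; apply: SD => //.
by apply/modquot_piP; rewrite /modquot_pi reprK.
Qed.

Fact modquot_scaleA a b q :
  modquot_scale a (modquot_scale b q) = modquot_scale (a * b) q.
Proof. by have [v ->] := modquot_pi_surj q; rewrite !modquot_scaleE scalerA. Qed.

Fact modquot_scale1 : left_id 1 modquot_scale.
Proof. by move=> q; have [v ->] := modquot_pi_surj q; rewrite modquot_scaleE scale1r. Qed.

Fact modquot_scaleDr : right_distributive modquot_scale +%R.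
Proof.
move=> a p q; have [u ->] := modquot_pi_surj p; have [v ->] := modquot_pi_surj q.
by rewrite -modquot_piD !modquot_scaleE scalerDr modquot_piD.
Qed.

Fact modquot_scaleDl q : {morph modquot_scale^~ q : a b / a + b}.
Proof.
move=> a b; have [v ->] := modquot_pi_surj q.
by rewrite !modquot_scaleE scalerDl modquot_piD.
Qed.

HB.instance Definition _ := GRing.Zmodule_isLmodule.Build R Q
  modquot_scaleA modquot_scale1 modquot_scaleDr modquot_scaleDl.

Lemma modquot_piZ a v : modquot_pi (a *: v) = a *: modquot_pi v.
Proof. by rewrite -modquot_scaleE. Qed.

Lemma modquot_pi_eq0 v : modquot_pi v = 0 <-> v \in S.
Proof.
have <- : modquot_pi 0 = 0 by rewrite -(scale0r 0) modquot_piZ scale0r.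
by rewrite modquot_piP subr0.
Qed.

End ModuleQuotient.

Arguments modquot {R V S} _.

(** * Column spaces over full matrix algebras *)

(* A copy of the column vectors, on which the scalars are square matrices.    *)
Definition colmod (R : nzRingType) (n : nat) : Type := 'cV[R]_n.+1.

Section ColumnModule.
Variables (R : nzRingType) (n : nat).
HB.instance Definition _ := GRing.Zmodule.copy (colmod R n) 'cV[R]_n.+1.

Definition colmod_scale (M : 'M[R]_n.+1) (x : colmod R n) : colmod R n := M *m x.
Fact colmod_scaleA a b x : colmod_scale a (colmod_scale b x) = colmod_scale (a * b) x.
Proof. exact: mulmxA. Qed.
Fact colmod_scale1 : left_id 1 colmod_scale.
Proof. exact: mul1mx. Qed.
Fact colmod_scaleDr : right_distributive colmod_scale +%R.
Proof. exact: mulmxDr. Qed.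
Fact colmod_scaleDl x : {morph colmod_scale^~ x : a b / a + b}.
Proof. by move=> a b; apply: mulmxDl. Qed.
HB.instance Definition _ := GRing.Zmodule_isLmodule.Build 'M[R]_n.+1 (colmod R n)
  colmod_scaleA colmod_scale1 colmod_scaleDr colmod_scaleDl.

Lemma colmodZ (M : 'M[R]_n.+1) (x : colmod R n) : M *: x = M *m x. Proof. by []. Qed.
End ColumnModule.

Section ColumnModuleField.
Variables (F : fieldType) (n : nat).

Lemma colmod_alg (c : F) (x : colmod F n) :
  (c%:A : 'M[F]_n.+1) *: x = (c *: (x : 'cV_n.+1) : 'cV_n.+1).
Proof. by rewrite colmodZ -scalemxAl mul1mx. Qed.

Lemma colmod_simple : simple_module (colmod F n).
Proof.
split.
  exists (const_mx 1 : 'cV_n.+1); apply/eqP => /matrixP/(_ 0 0)/eqP.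
  by rewrite !mxE oner_eq0.
move=> U [U0 UD].
have [[x Ux x0]|noU] := pselect (exists2 x, x \in U & x != 0); last first.
  left => x; rewrite !inE; apply/idP/eqP => [Ux|->//].
  by apply: contrapT => /eqP x0; apply: noU; exists x.
right => y; rewrite !inE.
have [i xi] : exists i, x i 0 != 0.
  apply: contrapT => H; case/negP: x0; apply/eqP/matrixP => i j; rewrite !ord1 mxE.
  by apply: contrapT => /eqP ?; apply: H; exists i.
(* A rank one matrix that sends x to y. *)
pose M : 'M[F]_n.+1 := ((x i 0)^-1 *: (y : 'cV_n.+1)) *m delta_mx 0 i.
suff -> : y = M *: x + 0 by apply: UD.
rewrite addr0 colmodZ -mulmxA -rowE; apply/matrixP => j k.
by rewrite !mxE big_ord1 !mxE !ord1 mulrAC mulVf ?mul1r.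
Qed.

Lemma colmod_fin : finite_dimensional (colmod F n).
Proof.
exists n.+1, (fun i => delta_mx i 0) => v; exists (fun i => v i 0).
transitivity (\sum_(i < n.+1) v i 0 *: (delta_mx i 0 : 'cV[F]_n.+1)).
  by rewrite {1}[LHS]matrix_sum_delta; apply: eq_bigr => i _; rewrite big_ord1.
by apply: eq_bigr => i _; rewrite colmod_alg.
Qed.

Lemma delta_mul_delta (M : 'M[F]_n.+1) i j k l :
  delta_mx i j * M * delta_mx k l = M j k *: delta_mx i l.
Proof.
have -> : delta_mx i j * M * delta_mx k l =
    (delta_mx i 0 : 'cV_n.+1) *m (row j M *m delta_mx k 0)
      *m (delta_mx 0 l : 'rV_n.+1).
  by rewrite rowE !mulmxA mul_delta_mx -(mulmxA _ _ (delta_mx 0 l)) mul_delta_mx.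
rewrite -colE [col k _]mx11_scalar !mxE mul_mx_scalar -scalemxAl.
by rewrite mul_delta_mx.
Qed.

Lemma matrix_central_simple : central_simple 'M[F]_n.+1.
Proof.
split.
  apply/vspaceP => M; apply/idP/idP => [|/vlineP[c ->]]; last first.
    by apply: memvZ; rewrite memv_cap memvf centv1.
  rewrite memv_cap => /andP[_ /centvP MC]; apply/vlineP; exists (M 0 0).
  have d00 : delta_mx 0 0 * M = M 0 0 *: delta_mx 0 0.
    by rewrite -delta_mul_delta -mulrA MC ?memvf // mulrA -mulmxE mul_delta_mx.
  apply/matrixP => i j; rewrite !mxE.
  (* Computing e_0i M e_j0 in two ways, once with M moved to the right, gives M_ij = M_00 if i = j
     and 0 otherwise. *)
  have := delta_mul_delta M 0 i j 0.
  rewrite -mulrA MC ?memvf // mulrA -mulmxE mul_delta_mx_cond mulmxE.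
  rewrite -scaler_nat -scalerAl d00 scalerA => /matrixP/(_ 0 0).
  by rewrite !mxE !mulr1 mulrC => <-.
move=> I IL IR.
have [[M MI M0]|noI] := pselect (exists2 M, M \in I & M != 0); last first.
  left; apply/eqP; rewrite -subv0; apply/subvP => M MI; rewrite memv0.
  apply: contrapT => /negP ?.
  by apply: noI; exists M.
right; apply/vspaceP => N; rewrite memvf.
have [j [k Mjk]] : exists j k, M j k != 0.
  apply: contrapT => H; case/negP: M0; apply/eqP/matrixP => j k; rewrite mxE.
  by apply: contrapT => /eqP ?; apply: H; exists j, k.
rewrite [N]matrix_sum_delta; apply: rpred_sum => i _; apply: rpred_sum => l _.
apply: rpredZ; suff: M j k *: delta_mx i l \in I.
  by move=> /(rpredZ (M j k)^-1); rewrite scalerA mulVf ?scale1r.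
rewrite -delta_mul_delta; apply: (subvP IR); rewrite memv_mul ?memvf //.
by apply: (subvP IL); rewrite memv_mul ?memvf.
Qed.
End ColumnModuleField.

(** * Limits of column spaces along chosen columns *)

Lemma col_mul (R : nzRingType) m n p (j : 'I_p)
    (M : 'M[R]_(m, n)) (N : 'M_(n, p)) :
  col j (M *m N) = M *m col j N.
Proof. by rewrite !colE mulmxA. Qed.

Section ColumnLimit.
Variables (F : fieldType) (A : algType F) (n : nat -> nat).
Variable phi : forall k, {lrmorphism 'M[F]_((n k).+1) -> 'M[F]_((n k.+1).+1)}.
Variable iota : forall k, {lrmorphism 'M[F]_((n k).+1) -> A}.
Hypothesis iota_limit : is_seq_limit (fun k => phi k) (fun k => iota k).
Hypothesis iota_inj : forall k, injective (iota k).

Section Column.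
Variable c : forall k, 'I_(n k).+1.
Hypothesis col_phi : forall k M, col (c k.+1) (phi k M) = 0 <-> col (c k) M = 0.

(* The annihilator of the limit of the basis vectors with indices c k; the    *)
(* direct limit of the column spaces is realized as the quotient by it.       *)
Definition col_ideal : {pred A^o} := fun a =>
  `[< exists k (M : 'M[F]_((n k).+1)), a = iota k M /\ col (c k) M = 0 >].

Lemma iota_lift k l (M : 'M[F]_((n k).+1)) : (k <= l)%N ->
  exists M' : 'M[F]_((n l).+1),
  iota k M = iota l M' /\ (col (c l) M' = 0 <-> col (c k) M = 0).
Proof.
elim: l => [|l IH]; first by rewrite leqn0 => /eqP k0; subst k; exists M.
rewrite leq_eqVlt => /orP[/eqP kl|]; first by subst k; exists M.
move=> /IH[M' [MM' cMM']]; exists (phi l M').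
have [iotaE _ _] := iota_limit.
by rewrite iotaE; split=> //; rewrite col_phi.
Qed.

Lemma iota_surj a k : exists2 l, (k <= l)%N & exists M, a = iota l M.
Proof.
have [_ /(_ a)[l [M <-]] _] := iota_limit.
have [M' [-> _]] := iota_lift M (leq_maxr k l).
by exists (maxn k l); [apply: leq_maxl | exists M'].
Qed.

(** Two representatives of an element become equal at a common stage by injectivity, and lifting
    respects the chosen column; so membership can be tested at any stage where the element lives. *)
Lemma iota_col_ideal k M : iota k M \in col_ideal <-> col (c k) M = 0.
Proof.
split=> [/asboolP[l [N [MN Nc]]]|]; last by move=> ?; apply/asboolP; exists k, M.
have [M' [EM <-]] := iota_lift M (leq_maxl k l).
have [N' [EN NN']] := iota_lift N (leq_maxr k l).
suff -> : M' = N' by rewrite NN'.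
by apply: (iota_inj (k := maxn k l)); rewrite -EM -EN.
Qed.

Lemma col_ideal_submod : GRing.submod_closed col_ideal.
Proof.
split; first by rewrite -(linear0 (iota 0%N)); apply/iota_col_ideal; rewrite linear0.
move=> a u v /asboolP[k [M [-> M0]]] /asboolP[l [N [-> N0]]].
have [m km [B ->]] := iota_surj a (maxn k l).
move: km; rewrite geq_max => /andP[km lm].
have [M' [-> MM']] := iota_lift M km; have [N' [-> NN']] := iota_lift N lm.
rewrite -[_ *: _]/(_ * _) -rmorphM -linearD; apply/iota_col_ideal.
by rewrite linearD /= -mulmxE col_mul (MM'.2 M0) (NN'.2 N0) mulmx0 addr0.
Qed.

Definition col_limit : lmodType A := modquot col_ideal_submod.

(** With v the class of 1, this is M v. By [col_inP] it depends only on column [c k] of M, so stage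
    k contributes a column space. *)
Definition col_in k (M : 'M[F]_((n k).+1)) : col_limit :=
  modquot_pi col_ideal_submod (iota k M).

Lemma col_in_eq0 k (M : 'M[F]_((n k).+1)) : col_in M = 0 <-> col (c k) M = 0.
Proof. by rewrite modquot_pi_eq0 iota_col_ideal. Qed.

Lemma col_inP k (M N : 'M[F]_((n k).+1)) :
  col_in M = col_in N <-> col (c k) M = col (c k) N.
Proof.
rewrite modquot_piP -linearB iota_col_ideal linearB /=.
by split=> [/subr0_eq|->]; rewrite ?subrr.
Qed.

Lemma col_in_surj v k :
  exists2 l, (k <= l)%N & exists M : 'M_((n l).+1), v = col_in M.
Proof.
have [a ->] := modquot_pi_surj v.
by have [l kl [M ->]] := iota_surj a k; exists l => //; exists M.
Qed.

Lemma col_in_phi k (M : 'M[F]_((n k).+1)) : col_in (phi k M) = col_in M.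
Proof. by rewrite /col_in; have [-> _ _] := iota_limit. Qed.

Lemma col_in_linear k (a : F) (M N : 'M[F]_((n k).+1)) :
  col_in (a *: M + N) = (a%:A : A) *: col_in M + col_in N.
Proof.
rewrite /col_in linearP modquot_piD; congr (_ + _).
by rewrite -[a *: iota k M]mulr_algl; apply: modquot_piZ.
Qed.

Lemma col_inM k (M N : 'M[F]_((n k).+1)) : col_in (M * N) = iota k M *: col_in N.
Proof. by rewrite /col_in rmorphM; apply: modquot_piZ. Qed.

Definition col_embed k (x : colmod F (n k)) : 'M[F]_((n k).+1) :=
  (x : 'cV_((n k).+1)) *m delta_mx 0 (c k).

Lemma col_embedK k (x : colmod F (n k)) : col (c k) (col_embed x) = x.
Proof. apply/matrixP => i j; rewrite /col_embed !mxE big_ord1.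
by rewrite !mxE !eqxx mulr1 !ord1.
Qed.

Lemma col_embed_linear k (a : F) (x y : colmod F (n k)) :
  col_embed ((a%:A : 'M_((n k).+1)) *: x + y) = a *: col_embed x + col_embed y.
Proof. by rewrite colmod_alg /col_embed mulmxDl -scalemxAl. Qed.

Lemma col_embedZ k (M : 'M[F]_((n k).+1)) (x : colmod F (n k)) :
  col_embed (M *: x) = M * col_embed x.
Proof. exact/esym/mulmxA. Qed.

Definition col_trans k (x : colmod F (n k)) : colmod F (n k.+1) :=
  col (c k.+1) (phi k (col_embed x)).

Lemma col_limit_locally_simple : locally_simple col_limit.
Proof.
split.
  exists (col_in (1 : 'M_((n 0%N).+1))).
  apply/eqP => /col_in_eq0/matrixP/(_ (c 0%N) 0)/eqP.
  by rewrite !mxE eqxx oner_eq0.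
exists (fun k => 'M[F]_((n k).+1)), phi, iota, (fun k => colmod F (n k)), col_trans.
exists (fun k x => col_in (col_embed x)); split=> //.
- by move=> k; apply: matrix_central_simple.
- by move=> k; split; [apply: colmod_simple|apply: colmod_fin].
- move=> k; split=> [a x y|a x]; rewrite /col_trans.
    by rewrite col_embed_linear !linearP colmod_alg.
  by rewrite col_embedZ rmorphM /= -mulmxE col_mul colmodZ.
- split; last first.
    move=> k; split=> [a x y|a x]; first by rewrite col_embed_linear col_in_linear.
    by rewrite col_embedZ col_inM.
  split.
  + by move=> k x; rewrite -[RHS]col_in_phi; apply/col_inP; rewrite col_embedK.
  + move=> v; have [k _ [M ->]] := col_in_surj v 0.
    exists k, (col (c k) M : colmod F (n k)).
    by apply/(col_inP (col_embed _)); rewrite col_embedK.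
  + move=> k x y xy; move/col_inP: xy; rewrite !col_embedK => ->; by exists 0%N.
Qed.

(** The idempotent e_jj kills every row of M but row j, while [col_inP] says that it leaves column
    [c k] unchanged. *)
Lemma col_limit_supported (v : col_limit) k (j : 'I_((n k).+1)) M :
    v = col_in M -> iota k (delta_mx j j) *: v = v ->
  forall i, i != j -> M i (c k) = 0.
Proof.
move=> -> /esym; rewrite -col_inM => /col_inP MM i /negPf ij.
move/matrixP/(_ i 0): MM; rewrite -mulmxE col_mul !mxE => ->.
by apply: big1 => l _; rewrite mxE ij mul0r.
Qed.

End Column.

(** The generator v is fixed by the idempotent of index [c k] at every stage, hence so is f v; at
    each stage where f v is visible, its column is supported in row [c k]. *)
Lemma col_limit_iso_support (c c' : forall k, 'I_((n k).+1))
    (Hc : forall k M, col (c k.+1) (phi k M) = 0 <-> col (c k) M = 0)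
    (Hc' : forall k M, col (c' k.+1) (phi k M) = 0 <-> col (c' k) M = 0) :
    isomorphic_modules (col_limit Hc) (col_limit Hc') ->
  exists m, forall k, (m <= k)%N -> exists M : 'M[F]_((n k).+1),
    M (c k) (c' k) != 0 /\ forall i, i != c k.+1 -> phi k M i (c' k.+1) = 0.
Proof.
move=> [f /bij_inj f_inj]; pose v := modquot_pi (col_ideal_submod Hc) 1.
have vE k : v = col_in Hc (1 : 'M_((n k).+1)) by rewrite /col_in rmorph1.
have fixed k : iota k (delta_mx (c k) (c k)) *: f v = f v.
  rewrite -linearZ; congr (f _); rewrite (vE k) -col_inM; apply/col_inP.
  by rewrite mulr1; apply/matrixP => i j; rewrite !mxE eqxx andbT.
have [m _ [M fvM]] := col_in_surj (f v) 0.
exists m => k mk; have [M' [MM' _]] := iota_lift Hc' M mk.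
have fvM' : f v = col_in Hc' M' by rewrite fvM /col_in MM'.
exists M'; split; last first.
  (* The same vector f v is represented by [phi k M'] at the next stage. *)
  by move=> i; apply: (col_limit_supported _) (fixed k.+1) _; rewrite col_in_phi.
apply/eqP => M0.
have: f v = 0.
  rewrite fvM'; apply/col_in_eq0/matrixP => i j; rewrite !mxE.
  have [->//|] := eqVneq i (c k).
  exact: (col_limit_supported fvM' (fixed k)).
rewrite -(linear0 f) => /f_inj; rewrite (vE 0%N).
move=> /col_in_eq0/matrixP/(_ (c 0%N) 0)/eqP.
by rewrite !mxE eqxx oner_eq0.
Qed.

End ColumnLimit.

(** * A cofinal chain of divisors *)

Section DivisorChain.
Variables (s : supernatural) (s_inf : sn_infinite s).

(** If no prime could be multiplied into d, every exponent of s would be finite and equal to that of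
    d, making s natural. *)
Lemma sn_dvd_prime_mul (d : sn_divisor s) : exists2 p, prime p & sn_dvd (p * d) s.
Proof.
apply: contrapT => Nex; apply: s_inf; exists d => [|p pp]; first exact: sn_divisor_gt0.
have d0 := sn_divisor_gt0 d; have /sn_dvdP[_ Hd] := valP d.
have pd0 : (0 < p * d)%N by rewrite muln_gt0 prime_gt0.
have lognpd q : prime q -> logn q (p * d) = ((q == p) + logn q d)%N.
  by move=> pq; rewrite (lognM q (prime_gt0 pp) d0) logn_prime.
case E: (s p) => [a|]; last first.
  case: Nex; exists p => //; apply/sn_dvdP; split=> // q b pq sq.
  by rewrite lognpd //; case: eqP sq => [->|_ /Hd->//]; rewrite E.
congr Some; apply/eqP; rewrite eqn_leq Hd // andbT leqNgt; apply/negP => lt_da.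
case: Nex; exists p => //; apply/sn_dvdP; split=> // q b pq sq.
by rewrite lognpd //; case: eqP sq => [->|_ /Hd->//]; rewrite E => -[<-].
Qed.

Lemma sn_divisor_step (d : sn_divisor s) k : exists e : sn_divisor s,
  [/\ (d %| e)%N, (d.*2 <= e)%N & sn_dvd k s -> (k %| e)%N].
Proof.
have [e de ke] : exists2 e : sn_divisor s, (d %| e)%N & sn_dvd k s -> (k %| e)%N.
  have [Hk|_] := boolP (sn_dvd k s); last by exists d.
  by exists (sn_lcm d (exist (fun m => sn_dvd m s) k Hk)) => [|_];
    [apply: dvdn_lcml|apply: dvdn_lcmr].
have [p pp Hpe] := sn_dvd_prime_mul e.
exists (exist (fun m => sn_dvd m s) (p * e)%N Hpe : sn_divisor s); split=> [||/ke Hk] /=;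
  try by apply: dvdn_mull.
by rewrite -mul2n leq_mul ?prime_gt1 // dvdn_leq ?sn_divisor_gt0.
Qed.

Lemma sn_divisor_chain : exists n : nat -> nat,
  [/\ forall k, sn_dvd (n k).+1 s,
      forall k, ((n k).+1 %| (n k.+1).+1)%N,
      forall k, ((n k).+1.*2 <= (n k.+1).+1)%N
    & forall e : sn_divisor s, exists k, (e %| (n k).+1)%N].
Proof.
have /choice[next nextP] := fun dk : sn_divisor s * nat => sn_divisor_step dk.1 dk.2.
(* Step l absorbs the number l when it divides s, so a divisor e divides D (e + 1): the chain is
   cofinal. *)
pose D := fix D k := if k is l.+1 then next (D l, l) else sn_div1 s.
have DE k : (D k).-1.+1 = D k by rewrite prednK ?sn_divisor_gt0.
exists (fun k => (D k).-1); split=> [k|k|k|e]; rewrite ?DE.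
- exact: (valP (D k)).
- by have [] := nextP (D k, k).
- by have [] := nextP (D k, k).
- exists e.+1; rewrite DE; have [_ _ ] := nextP (D e, e : nat).
  by apply; exact: (valP e).
Qed.

End DivisorChain.

(** * Stages of the algebra as matrix rings *)

Section Stages.
Variables (F : fieldType) (s : supernatural).

Definition sn_stage d (Hd : sn_dvd d.+1 s) : sn_divisor s :=
  exist (fun m => sn_dvd m s) d.+1 Hd.

Definition stage_in d (Hd : sn_dvd d.+1 s) (x : 'M[F]_d.+1) : smx F s :=
  @smx_in F s (sn_stage Hd) x.

HB.instance Definition _ d Hd := GRing.isLinear.Build F 'M[F]_d.+1 (smx F s) *:%R
  (@stage_in d Hd)
  (fun a x y => etrans (smx_inD _ _) (congr1 (+%R^~ _) (smx_inZ _ _))).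
HB.instance Definition _ d Hd := GRing.isMonoidMorphism.Build 'M[F]_d.+1 (smx F s)
  (@stage_in d Hd) (smx_in1 F (sn_stage Hd), @smx_inM F s (sn_stage Hd)).

(* The argument de is there for the morphism structures below to depend on it. *)
Definition stage_trans d e (Hd : sn_dvd d.+1 s) (He : sn_dvd e.+1 s)
    (de : (d.+1 %| e.+1)%N) (x : 'M[F]_d.+1) : 'M[F]_e.+1 :=
  @blockdiag F s (sn_stage Hd) (sn_stage He) x.

Section Trans.
Variables (d e : nat) (Hd : sn_dvd d.+1 s) (He : sn_dvd e.+1 s).
Variable de : (d.+1 %| e.+1)%N.
Local Notation f := (stage_trans Hd He de).

Fact stage_trans_linear : linear f.
Proof. by move=> a x y; rewrite /f blockdiagD blockdiagZ. Qed.

Fact stage_trans_monoid : monoid_morphism f.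
Proof.
split; first exact: (blockdiag1 F (sn_stage Hd) (sn_stage He)).
by move=> x y; apply: (@blockdiagM F s (sn_stage Hd) (sn_stage He)).
Qed.

HB.instance Definition _ := GRing.isLinear.Build F 'M[F]_d.+1 'M[F]_e.+1 *:%R
  f stage_trans_linear.
HB.instance Definition _ := GRing.isMonoidMorphism.Build 'M[F]_d.+1 'M[F]_e.+1
  f stage_trans_monoid.

Lemma stage_transE (M : 'M[F]_d.+1) (i j : 'I_e.+1) (i' j' : 'I_d.+1) :
    i = i' %[mod d.+1] -> j = j' %[mod d.+1] ->
  f M i j = if (i %/ d.+1 == j %/ d.+1)%N then M i' j' else 0.
Proof.
move=> ii' jj'; rewrite !mxE /=.
have -> : sn_ord (sn_stage Hd) i = i'.
  by apply: val_inj; rewrite /= -[LHS]/(i %% d.+1)%N ii' modn_small.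
have -> // : sn_ord (sn_stage Hd) j = j'.
by apply: val_inj; rewrite /= -[LHS]/(j %% d.+1)%N jj' modn_small.
Qed.

End Trans.
End Stages.

(** * Modules attached to digit sequences *)

Section DigitModules.
Variables (F : fieldType) (s : supernatural) (n : nat -> nat).
Hypothesis n_dvd : forall k, sn_dvd (n k).+1 s.
Hypothesis n_step : forall k, ((n k).+1 %| (n k.+1).+1)%N.
Hypothesis n_double : forall k, ((n k).+1.*2 <= (n k.+1).+1)%N.
Hypothesis n_cofinal : forall e : sn_divisor s, exists k, (e %| (n k).+1)%N.

Definition chain_trans k : {lrmorphism 'M[F]_((n k).+1) -> 'M[F]_((n k.+1).+1)} :=
  stage_trans (n_dvd k) (n_dvd k.+1) (n_step k).

Definition chain_in k : {lrmorphism 'M[F]_((n k).+1) -> smx F s} :=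
  stage_in (n_dvd k).

Lemma chain_in_inj k : injective (chain_in k).
Proof. by move=> x y; apply: (@smx_in_inj F s (sn_stage (n_dvd k))). Qed.

Lemma chain_limit : is_seq_limit (fun k => chain_trans k) (fun k => chain_in k).
Proof.
split=> [k x|a|k x y /chain_in_inj->]; last by exists 0%N.
  exact: (@smx_in_blockdiag F s (sn_stage (n_dvd k)) (sn_stage (n_dvd k.+1))
            x (n_step k)).
have [d [x ->]] := smx_in_surj a; have [k dk] := n_cofinal d.
exists k, (blockdiag (sn_stage (n_dvd k)) x).
exact: (@smx_in_blockdiag F s d (sn_stage (n_dvd k)) x dk).
Qed.

Section Digits.
Variable eps : nat -> bool.

(** The index c_k, a mixed radix expansion with digits [eps]; [n_double] leaves room for the digits
    0 and 1. *)
Fixpoint digit_sum k : nat :=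
  if k is l.+1 then (eps l * (n l).+1 + digit_sum l)%N else 0.

Lemma digit_sum_lt k : (digit_sum k < (n k).+1)%N.
Proof.
elim: k => //= k IH; apply: leq_trans (n_double k).
by case: (eps k); lia.
Qed.

Definition digit_ord k : 'I_((n k).+1) := Ordinal (digit_sum_lt k).

Lemma digit_ord_div k : (digit_ord k.+1 %/ (n k).+1)%N = eps k.
Proof. by rewrite /= divnMDl // divn_small ?addn0 // digit_sum_lt. Qed.

Lemma digit_ord_mod k : digit_ord k.+1 = digit_ord k %[mod (n k).+1].
Proof. by rewrite /= modnMDl. Qed.

Lemma digit_lift k (i : 'I_((n k).+1)) : exists i' : 'I_((n k.+1).+1),
  i' = i %[mod (n k).+1] /\ (i' %/ (n k).+1)%N = eps k.
Proof.
have lt_i : (eps k * (n k).+1 + i < (n k.+1).+1)%N.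
  apply: leq_trans (n_double k); case: i => i /= ?; by case: (eps k); lia.
exists (Ordinal lt_i); rewrite /= modnMDl divnMDl // divn_small ?addn0 //.
Qed.

(** Column c_(k+1) of diag(M, ..., M) is column c_k of M placed in block [eps k], with zeros
    elsewhere. *)
Lemma col_chain_trans k M :
  col (digit_ord k.+1) (chain_trans k M) = 0 <-> col (digit_ord k) M = 0.
Proof.
split=> /matrixP M0; apply/matrixP => i j; rewrite [RHS]mxE mxE.
  have [i' [ii' i'E]] := digit_lift i.
  have := M0 i' j; rewrite [RHS]mxE mxE.
  by rewrite (stage_transE _ _ _ _ ii' (digit_ord_mod k)) i'E digit_ord_div eqxx.
pose i' : 'I_((n k).+1) := Ordinal (ltn_pmod i (ltn0Sn (n k))).
have ii' : i = i' %[mod (n k).+1] by rewrite modn_mod.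
rewrite (stage_transE _ _ _ _ ii' (digit_ord_mod k)); case: ifP => // _.
by have := M0 i' j; rewrite [RHS]mxE mxE.
Qed.

Definition digit_module : lmodType (smx F s) :=
  col_limit chain_limit chain_in_inj col_chain_trans.

Lemma digit_module_locally_simple : locally_simple digit_module.
Proof. exact: col_limit_locally_simple. Qed.

End Digits.

Lemma digit_module_iso (eps eps' : nat -> bool) :
    isomorphic_modules (digit_module eps) (digit_module eps') ->
  exists m, forall k, (m <= k)%N -> eps k = eps' k.
Proof.
move=> /col_limit_iso_support[m supp]; exists m => k /supp[M [M0 phiM]].
(* Row i is the copy of row c_k in block [eps' k]. Its entry in column c'_(k+1) is nonzero, so i
   must be c_(k+1), which lies in block [eps k]. *)
have [i [ii iE]] := digit_lift eps' (digit_ord eps k).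
have : chain_trans k M i (digit_ord eps' k.+1) != 0.
  rewrite (stage_transE _ _ _ _ ii (digit_ord_mod eps' k)).
  by rewrite iE digit_ord_div eqxx.
have [ic _|/phiM->] := eqVneq i (digit_ord eps k.+1); last by rewrite eqxx.
by move: iE; rewrite ic digit_ord_div; do 2!case: (_ k).
Qed.

End DigitModules.

(** * Uncountably many isomorphism classes *)

Lemma uncountable_nat_bool : uncountable (nat -> bool).
Proof.
move=> /countable_injP[f f_inj].
have fI : injective f by move=> x y; apply: f_inj; rewrite in_setT.
(* Cantor's diagonal set for the injection f. *)
pose d m := `[< exists2 x, f x = m & ~~ x m >].
have [dd|nd] := boolP (d (f d)).
  by have /asboolP[x /fI->] := dd; rewrite dd.
by case/negP: (nd); apply/asboolP; exists d.
Qed.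

Theorem corollary6p7 (s : supernatural) (hs : sn_infinite s) (F : fieldType) :
  exists (I : Type) (V : I -> lmodType (smx F s)),
    [/\ uncountable I,
        forall i : I, locally_simple (V i)
      & forall i j : I, i <> j -> ~ isomorphic_modules (V i) (V j)].
Proof.
have [n [n_dvd n_step n_double n_cofinal]] := sn_divisor_chain hs.
pose eps (al : nat -> bool) k := al (logn 2 k.+1).
exists (nat -> bool).
exists (fun al => digit_module F n_dvd n_step n_double n_cofinal (eps al)).
split=> [|al|al be al_be]; first exact: uncountable_nat_bool.
  exact: digit_module_locally_simple.
move=> /digit_module_iso[m al_eq_be]; apply: al_be; apply/funext => x.
(* The odd factor 2m + 1 keeps the 2-adic valuation equal to x and pushes position k - 1 past m. *)
pose k := (2 ^ x * m.*2.+1)%N.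
have k0 : (0 < k)%N by rewrite muln_gt0 expn_gt0.
have kx : logn 2 k = x.
  rewrite lognM ?expn_gt0 // pfactorK // logn_coprime ?addn0 //.
  by rewrite coprime2n /= odd_double.
have mk : (m <= k.-1)%N.
  rewrite -ltnS prednK //; apply: leq_trans (leq_pmull _ _); last by rewrite expn_gt0.
  by rewrite ltnS -addnn leq_addr.
by have := al_eq_be _ mk; rewrite /eps prednK // kx.
Qed.
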